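(* In the two-stage school choice model with preparatory actions: the Student-Proposing Deferred Acceptance mechanism (DA) is strategy-proof but the Immediate Acceptance mechanism (IA) is not; however, neither DA nor IA is deception-proof.
   Context: Model. An economy consists of a finite set $\mathcal{I}$ of students, a finite set $\mathcal{S}$ of schools, a finite capacity $C_s$ for each $s\in\mathcal{S}$, a manipulability level $w\in[0,1]$, a deception cost $\gamma>0$ (the same for all students), and for each student $i$: an action set $A_i$ with $|A_i|\ge 2$ and a distinguished null action $a_i^0\in A_i$; utilities $v_{i,s}\in\mathbb{R}$ from being matched to school $s$, with ordinal preferences that are strict over $\mathcal{S}$ (being unmatched gives utility $0$); non-manipulable priority scores $p^{exog}_{i,s}\in[0,1]$; and manipulable priority scores given by functions $p^{manip}_{i,s}:A_i\to[0,1]$. In stage one each student $i$ chooses a preparatory action $a_i\in A_i$, which is private information to the student; $i$ deceives if $a_i\ne a_i^0$. The realized priority of $i$ at $s$ is $$p_{i,s}(a_i)=w\,p^{manip}_{i,s}(a_i)+(1-w)\,p^{exog}_{i,s}.$$ In stage two each student submits a rank order list $L_i$ over schools. A mechanism uses the lists, the capacities and the realized priorities (higher priorities first) to produce a matching $\mu:\mathcal{I}\to\mathcal{S}\cup\{\emptyset\}$ with at most $C_s$ students at each $s$. The utility of $i$ is $v_{i,\mu(i)}$ (with $v_{i,\emptyset}=0$), minus $\gamma$ if $i$ deceives. Students only deceive if they strictly benefit in terms of utility. A strategy of a student consists of a preparatory action and a rank order list. DA and IA are the standard school choice mechanisms. DA: in each round every student not currently held proposes to the best school on her list that has not yet rejected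 her; each school tentatively holds the highest-priority students among those it currently holds and its new proposers, up to capacity, and rejects the rest; the procedure stops when there are no new rejections, and tentative assignments become final. IA (also called the Boston mechanism): in round $k$ each unassigned student applies to her $k$-th listed school; each school permanently admits the highest-priority applicants up to its remaining capacity and rejects the rest. A mechanism is strategy-proof if for every student, for all of her preparatory actions, and for all strategies of the other students, it is optimal for her to report her ordinal preferences truthfully. A mechanism is deception-proof if for every student and for all strategies of the other students, it is optimal not to deceive. Both properties are required to hold in every economy of the model. *)

(* Defs.v *)
From HB Require Import structures.
From mathcomp Require Import all_boot all_order all_algebra.
From mathcomp Require Import reals.

Set Implicit Arguments.
Unset Strict Implicit.
Unset Printing Implicit Defensive.
Import Order.TTheory GRing.Theory Num.Theory.
Local Open Scope ring_scope.

Record economy (R : realType) := Economy {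
  student : finType;
  school : finType;
  capacity : school -> nat;
  manip_level : R;
  manip_level_itv : 0 <= manip_level <= 1;
  deception_cost : R;
  deception_cost_gt0 : 0 < deception_cost;
  (* not necessarily finite; [action_ge2] says that there are at least two *)
  action : student -> eqType;
  null_action : forall i, action i;
  action_ge2 : forall i, exists a : action i, a != null_action i;
  value : student -> school -> R;
  value_strict : forall i, injective (value i);
  prio_exog : student -> school -> R;
  prio_exog_itv : forall i s, 0 <= prio_exog i s <= 1;
  prio_manip : forall i : student, school -> action i -> R;
  prio_manip_itv : forall i s (a : action i), 0 <= prio_manip s a <= 1
}.

Definition realized_prio (R : realType) (E : economy R) (i : student E)
    (s : school E) (a : action i) : R :=
  manip_level E * prio_manip s a + (1 - manip_level E) * prio_exog i s.

(* A rank order list may be partial: schools left out are never proposed to. *)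
Definition rol (S : finType) := {L : seq S | uniq L}.

Record mechanism (R : realType) := Mechanism {
  assign :> forall I S : finType, (S -> nat) -> (I -> S -> R) -> (I -> rol S) ->
    {ffun I -> option S};
  assign_feasible : forall (I S : finType) (C : S -> nat) (p : I -> S -> R)
    (L : I -> rol S) (s : S),
    (#|[set i | assign C p L i == Some s]| <= C s)%N
}.

(* Realized priorities may coincide, so "the highest-priority students" needs a
   tie-breaker: at each school, ties are resolved in favour of the student with
   the smaller number, independently of priorities and reports. *)
Record tie_breaking := TieBreaking {
  tie_rank :> forall I S : finType, S -> I -> nat;
  tie_rank_inj : forall (I S : finType) (s : S), injective (@tie_rank I S s)
}.

Section Selection.
Variables (R : realType) (tb : tie_breaking) (I S : finType) (p : I -> S -> R).

Definition outranks (s : S) (i j : I) : bool :=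
  (p j s < p i s) || ((p i s == p j s) && (tb I S s i < tb I S s j)%N).

(* the [q] students of [X] ranked highest at [s] (all of [X] if there are
   fewer than [q]) *)
Definition top (q : nat) (s : S) (X : {set I}) : {set I} :=
  [set i in X | (#|[set j in X | outranks s j i]| < q)%N].

Lemma outranks_irr s i : outranks s i i = false.
Proof. by rewrite /outranks ltxx ltnn andbF. Qed.

Lemma outranks_trans s : transitive (outranks s).
Proof.
move=> j i k; rewrite /outranks => /orP[ji|/andP[/eqP-> tij]].
  move=> /orP[kj|/andP[/eqP <- _]]; last by rewrite ji.
  by rewrite (lt_trans kj ji).
move=> /orP[->//|/andP[-> tjk]]; by rewrite (ltn_trans tij tjk) orbT.
Qed.

Lemma outranks_total s i j : i != j -> outranks s i j || outranks s j i.
Proof.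
rewrite /outranks => ij; case: (ltgtP (p i s) (p j s)) => //= _.
case: (ltngtP (tb I S s i) (tb I S s j)) => // /tie_rank_inj eij.
by rewrite eij eqxx in ij.
Qed.

Lemma card_top q s X : (#|top q s X| <= q)%N.
Proof.
pose r i := #|[set j in X | outranks s j i]|.
have r_lt i j : i \in X -> outranks s i j -> (r i < r j)%N.
  move=> iX oij; apply/proper_card/properP; split.
    apply/subsetP=> k; rewrite !inE => /andP[-> /=] oki.
    exact: outranks_trans oki oij.
  by exists i; rewrite !inE iX // outranks_irr.
rewrite cardE -(size_map r) -[leqRHS](size_iota 0) uniq_leq_size//.
  rewrite map_inj_in_uniq ?enum_uniq// => i j.
  rewrite !mem_enum !inE => /andP[iX _] /andP[jX _] rij.
  apply/eqP/negP=> /negP /(outranks_total s) /orP[] /r_lt.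
    by move=> /(_ iX); rewrite rij ltnn.
  by move=> /(_ jX); rewrite rij ltnn.
move=> n /mapP[i]; rewrite mem_enum inE => /andP[_ ri] ->.
by rewrite mem_iota.
Qed.

Lemma top_sub q s X : top q s X \subset X.
Proof. by apply/subsetP=> i; rewrite inE => /andP[]. Qed.

End Selection.

Lemma ohead_filter (T : Type) (P : pred T) (r : seq T) (x : T) :
  ohead [seq y <- r | P y] = Some x -> P x.
Proof. by elim: r => //= y r IHr; case: ifP => // Py [<-]. Qed.

Section DeferredAcceptance.
Variables (R : realType) (tb : tie_breaking) (I S : finType).
Variables (C : S -> nat) (p : I -> S -> R) (L : I -> rol S).

(* tentative assignment, and the set of rejections issued so far *)
Definition da_state := ({ffun I -> option S} * {set I * S})%type.

Definition da_start : da_state := ([ffun=> None], set0).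

(* where [i] stands in the next round: with the school holding her if there is
   one, else with the best listed school that has not yet rejected her *)
Definition da_target (st : da_state) (i : I) : option S :=
  if st.1 i is Some s then Some s
  else ohead [seq s <- val (L i) | (i, s) \notin st.2].

Definition da_kept (st : da_state) (s : S) : {set I} :=
  top tb p (C s) s [set i | da_target st i == Some s].

Definition da_round (st : da_state) : da_state :=
  ([ffun i => if da_target st i is Some s then
                if i \in da_kept st s then Some s else None
              else None],
   st.2 :|: [set x : I * S | (da_target st x.1 == Some x.2)
                             && (x.1 \notin da_kept st x.2)]).

(* Every round before the last one issues a new rejection, hence this number of
   rounds reaches the end of the procedure; see [da_final_stable]. *)
Definition da_final : da_state := iter (#|I| * #|S|).+1 da_round da_start.

Lemma da_round_feasible st s :
  (#|[set i | (da_round st).1 i == Some s]| <= C s)%N.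
Proof.
apply: leq_trans (card_top tb p (C s) s [set i | da_target st i == Some s]).
apply/subset_leq_card/subsetP => i; rewrite inE /= ffunE.
case: (da_target st i) => // s'; case: ifP => // + /eqP[<-]; by [].
Qed.

Lemma da_round_stop st :
  (da_round st).2 = st.2 -> (forall i s, st.1 i = Some s -> (i, s) \notin st.2) ->
  da_round (da_round st) = da_round st.
Proof.
move=> st2 held.
have tE i : da_target (da_round st) i = da_target st i.
  rewrite {1}/da_target st2 /= ffunE.
  case E: (da_target st i) => [s|]; last first.
    by move: E; rewrite /da_target; case: (st.1 i).
  case: ifPn => // ni.
  have rej : (i, s) \in st.2 by rewrite -st2 in_setU in_set /= E eqxx ni orbT.
  move: E; rewrite /da_target; case E1: (st.1 i) => [s'|].
    by case=> ?; subst s'; rewrite (negbTE (held _ _ E1)) in rej.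
  by [].
have kE s : da_kept (da_round st) s = da_kept st s.
  by rewrite /da_kept; congr top; apply/setP=> i; rewrite !inE tE.
have roundE st' : (forall i, da_target st' i = da_target st i) ->
    (forall s, da_kept st' s = da_kept st s) ->
    da_round st' = ((da_round st).1,
      st'.2 :|: [set x : I * S | (da_target st x.1 == Some x.2)
                                 && (x.1 \notin da_kept st x.2)]).
  move=> tE' kE'; congr pair.
    apply/ffunP=> i; rewrite [LHS]ffunE [RHS]ffunE tE'.
    by case: (da_target st i) => // s; rewrite kE'.
  by congr (_ :|: _); apply/setP=> x; rewrite [LHS]in_set [RHS]in_set tE' kE'.
rewrite (roundE _ tE kE) [RHS]surjective_pairing; congr pair.
by rewrite /= -setUA setUid.
Qed.

Lemma da_held_not_rejected n i s :
  (iter n da_round da_start).1 i = Some s ->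
  (i, s) \notin (iter n da_round da_start).2.
Proof.
elim: n i s => [|n IHn] i s; first by rewrite ffunE.
rewrite iterS; set st := iter n _ _ in IHn *.
rewrite /= ffunE; case E: (da_target st i) => [s'|//].
case: ifP => // k [?]; subst s'; rewrite in_setU in_set /= k andbF orbF.
move: E; rewrite /da_target; case E1: (st.1 i) => [s'|].
  by case=> <-; exact: IHn.
by move=> e; have := ohead_filter e.
Qed.

Lemma da_final_stable : da_round da_final = da_final.
Proof.
pose st n := iter n da_round da_start.
have sub n : (st n).2 \subset (st n.+1).2 by rewrite /st iterS subsetUl.
have stS n : st n.+1 = da_round (st n) by [].
have fix_after n : (st n.+1).2 = (st n).2 -> forall m, (n < m)%N -> st m = st n.+1.
  move=> e; elim=> // m IHm; rewrite ltnS leq_eqVlt => /predU1P[<-//|/IHm stm].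
  rewrite [LHS]stS stm stS; apply: da_round_stop; first by rewrite -stS.
  exact: da_held_not_rejected.
have [/existsP[n /eqP e]|/existsPn nx] :=
    boolP [exists n : 'I_(#|I| * #|S|).+1, (st n.+1).2 == (st n).2].
  have fin m : (#|I| * #|S| < m)%N -> st m = st n.+1.
    by move=> m_gt; apply: fix_after => //; apply: leq_trans m_gt.
  by rewrite -[LHS]/(st (#|I| * #|S|).+2) -[RHS]/(st (#|I| * #|S|).+1) !fin.
have grow n : (n <= (#|I| * #|S|).+1)%N -> (n <= #|(st n).2|)%N.
  elim: n => // n IHn nN; apply: leq_ltn_trans (IHn (ltnW nN)) _.
  apply/proper_card; rewrite properEneq sub eq_sym andbT.
  exact: (nx (Ordinal nN)).
have := grow _ (leqnn _); rewrite leqNgt ltnS -card_prod.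
by rewrite max_card.
Qed.

End DeferredAcceptance.

Lemma da_feasible (R : realType) (tb : tie_breaking) (I S : finType)
    (C : S -> nat) (p : I -> S -> R) (L : I -> rol S) (s : S) :
  (#|[set i | (da_final tb C p L).1 i == Some s]| <= C s)%N.
Proof. exact: da_round_feasible. Qed.

Definition DA (R : realType) (tb : tie_breaking) : mechanism R :=
  Mechanism (da_feasible (R := R) tb).

Section ImmediateAcceptance.
Variables (R : realType) (tb : tie_breaking) (I S : finType).
Variables (C : S -> nat) (p : I -> S -> R) (L : I -> rol S).

(* Rounds are numbered from 0: in round [k] the unassigned students apply to
   entry [k] of their lists, entries being numbered from 0 as well. *)
Definition ia_applicants (mu : {ffun I -> option S}) (k : nat) (s : S) : {set I} :=
  [set i | (mu i == None) && (onth (val (L i)) k == Some s)].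

Definition ia_admitted (mu : {ffun I -> option S}) (k : nat) (s : S) : {set I} :=
  top tb p (C s - #|[set i | mu i == Some s]|)%N s (ia_applicants mu k s).

Definition ia_round (mu : {ffun I -> option S}) (k : nat) :
    {ffun I -> option S} :=
  [ffun i => if mu i is Some s then Some s
             else if onth (val (L i)) k is Some s then
               if i \in ia_admitted mu k s then Some s else None
             else None].

(* the length of a list never exceeds [#|S|] *)
Definition ia_final : {ffun I -> option S} :=
  foldl ia_round [ffun=> None] (iota 0 #|S|).

Lemma ia_round_feasible (mu : {ffun I -> option S}) k s :
  (#|[set i | mu i == Some s]| <= C s)%N ->
  (#|[set i | ia_round mu k i == Some s]| <= C s)%N.
Proof.
move=> Cs; rewrite -(subnKC Cs).
apply: leq_trans (leq_add (leqnn _) (card_top tb p _ s (ia_applicants mu k s))).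
apply: leq_trans (leq_card_setU _ _).
apply/subset_leq_card/subsetP => i; rewrite in_setU !inE ffunE.
case E: (mu i) => [s'|]; first by move=> ->.
case E': (onth _ k) => [s'|] //; case: ifP => // + /eqP[?]; subst s'.
by rewrite !inE E E'.
Qed.

End ImmediateAcceptance.

Lemma ia_feasible (R : realType) (tb : tie_breaking) (I S : finType)
    (C : S -> nat) (p : I -> S -> R) (L : I -> rol S) (s : S) :
  (#|[set i | ia_final tb C p L i == Some s]| <= C s)%N.
Proof.
rewrite /ia_final; set mu0 := finfun _.
have : (#|[set i | mu0 i == Some s]| <= C s)%N.
  by rewrite (_ : [set _ | _] = set0) ?cards0//; apply/setP=> i; rewrite !inE ffunE.
elim: iota mu0 => //= k r IHr mu /(ia_round_feasible tb p L k).
exact: IHr.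
Qed.

Definition IA (R : realType) (tb : tie_breaking) : mechanism R :=
  Mechanism (ia_feasible (R := R) tb).

Section Game.
Variables (R : realType) (phi : mechanism R) (E : economy R).

Definition strategy (i : student E) : Type := (action i * rol (school E))%type.
Definition profile : Type := forall i : student E, strategy i.

Definition outcome (sigma : profile) : {ffun student E -> option (school E)} :=
  phi _ _ (@capacity R E) (fun i s => realized_prio s (sigma i).1)
    (fun i => (sigma i).2).

Definition utility (sigma : profile) (i : student E) : R :=
  (if outcome sigma i is Some s then value i s else 0)
  - (if (sigma i).1 == null_action i then 0 else deception_cost E).

Definition play (sigma : profile) (i : student E) (x : strategy i) : profile :=
  dfwith sigma x.

(* Strictly decreasing in utility and cut at the utility 0 of being unmatched;
   a school worth exactly 0 may be listed or not. *)
Definition truthful (i : student E) (L : rol (school E)) : Prop :=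
  [/\ sorted (fun s t => value i t < value i s) (val L),
      forall s, 0 < value i s -> s \in val L
    & forall s, s \in val L -> 0 <= value i s].

Definition best_response (sigma : profile) (i : student E) (x : strategy i) : Prop :=
  forall y : strategy i, utility (play sigma y) i <= utility (play sigma x) i.

End Game.

Arguments utility {R} phi {E}.
Arguments best_response {R} phi {E}.

(* [sigma i] plays no role below: only the strategies of the others matter. *)
Definition strategy_proof (R : realType) (phi : mechanism R) : Prop :=
  forall (E : economy R) (sigma : profile E) (i : student E) (a : action i)
    (L : rol (school E)), truthful i L ->
  forall L' : rol (school E),
    utility phi (play sigma (a, L')) i <= utility phi (play sigma (a, L)) i.

Definition deception_proof (R : realType) (phi : mechanism R) : Prop :=
  forall (E : economy R) (sigma : profile E) (i : student E),
  exists L : rol (school E), best_response phi sigma i (null_action i, L).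

(* Main.v *)
(** Deferred acceptance yields a stable matching, and no student is ever
    rejected by a school that some stable matching gives her.  Hence every
    stable matching matches the same students.  If a misreport gave student
    [i] a school [s] better than her truthful assignment, the matching it
    produces would remain stable when [i] lists only [s].  Truncating the
    truthful list just above the truthful assignment leaves [i] unmatched, and
    the resulting matching is also stable when [i] lists only [s]; but stable
    matchings match the same students.

    For the negative results, take two students and one seat that both want.
    Student [true] holds the lower priority there unless she deceives, so
    deceiving pays.  When she does deceive, ranking a school without seats
    first makes her lose the contested seat in the first round of immediate
    acceptance. *)

Require Import Defs.
From mathcomp Require Import all_boot all_order all_algebra.
From mathcomp Require Import boolp reals lra.

Set Implicit Arguments.
Unset Strict Implicit.
Unset Printing Implicit Defensive.
Import Order.TTheory GRing.Theory Num.Theory.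
Local Open Scope ring_scope.

(** * Stable matchings and the selection of top students *)

Section Stability.
Variables (R : realType) (tb : tie_breaking) (I S : finType).
Variables (C : S -> nat) (p : I -> S -> R).
Implicit Types (L : I -> rol S) (mu : I -> option S).

Definition prefers (l : seq S) (o : option S) (t : S) : bool :=
  (t \in l) && (if o is Some s then (index t l < index s l)%N else true).

(* With feasibility, the last clause says that the seats of [t] are all filled
   by students outranking [i], so it excludes both wasted seats and envy. *)
Record stable L mu : Prop := Stable {
  stable_listed : forall i s, mu i = Some s -> s \in val (L i);
  stable_feasible : forall s, (#|[set i | mu i == Some s]| <= C s)%N;
  stable_unblocked : forall i t, prefers (val (L i)) (mu i) t ->
    (C t <= #|[set j | (mu j == Some t) && outranks tb p t j i]|)%N
}.

Lemma lt_not_outranks s i j : p j s < p i s -> ~~ outranks tb p s j i.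
Proof. by move=> ji; rewrite /outranks ltNge (ltW ji) (lt_eqF ji). Qed.

(** Among the students outranking [i] that the selection drops, take [k] with the fewest students of
    [X] above her. By minimality all of those are selected, and they outrank [i]; if they were fewer
    than [q], [k] would be selected too. *)
Lemma card_top_outranking q s (X : {set I}) i :
  (q <= #|[set j in X | outranks tb p s j i]|)%N ->
  (q <= #|[set j in top tb p q s X | outranks tb p s j i]|)%N.
Proof.
move=> qX; rewrite leqNgt; apply/negP => Zq.
pose r k := #|[set j in X | outranks tb p s j k]|.
pose bad k := [&& k \in X, outranks tb p s k i & k \notin top tb p q s X].
have [k0 bad0] : exists k, bad k.
  have /subsetPn[k] : ~~ ([set j in X | outranks tb p s j i] \subset
      [set j in top tb p q s X | outranks tb p s j i]).
    by apply/negP => /subset_leq_card /(leq_trans qX); rewrite leqNgt Zq.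
  rewrite !in_set => /andP[kX ki]; rewrite ki andbT kX /= => kq.
  by exists k; rewrite /bad kX ki in_set kX.
case: (arg_minnP r bad0) => k /and3P[kX ki kN] kmin.
case/negP: kN; rewrite inE kX /=; apply: leq_ltn_trans Zq.
apply/subset_leq_card/subsetP => j; rewrite in_set => /andP[jX jk].
have ji := outranks_trans jk ki.
rewrite in_set ji andbT; apply/negPn/negP => jN.
have /kmin : bad j by rewrite /bad jX ji jN.
rewrite leqNgt => /negP[]; apply/proper_card/properP; split.
  apply/subsetP => l; rewrite !inE => /andP[-> /= lj].
  exact: outranks_trans lj jk.
by exists j; rewrite !inE jX // outranks_irr.
Qed.

(** * Deferred acceptance: stability and optimality for students *)

Section Run.
Variable L : I -> rol S.
Notation round := (da_round tb C p L).

Definition best (st : da_state I S) (i : I) : option S :=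
  ohead [seq s <- val (L i) | (i, s) \notin st.2].

Lemma bestP st i s : best st i = Some s ->
  (s \in val (L i)) /\ (i, s) \notin st.2.
Proof.
move=> e; have : s \in [seq s <- val (L i) | (i, s) \notin st.2].
  by move: e; rewrite /best; case: filter => // x r [->]; rewrite mem_head.
by rewrite mem_filter => /andP[-> ->].
Qed.

Lemma ohead_filter_index (l : seq S) (P : pred S) t :
  t \in l -> P t ->
  exists2 s, ohead (filter P l) = Some s & (index s l <= index t l)%N.
Proof.
elim: l => //= x l IHl; rewrite in_cons => tl Pt.
case: ifP => [_|Px]; first by exists x; rewrite ?eqxx.
have tx : (t == x) = false by apply/eqP => e; rewrite -e Pt in Px.
case: IHl => // [|s es st]; first by rewrite tx in tl.
exists s => //; rewrite [x == t]eq_sym tx.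
by case: eqP => // e; rewrite e (ohead_filter es) in Px.
Qed.

Lemma best_le (st : da_state I S) i t : t \in val (L i) -> (i, t) \notin st.2 ->
  exists2 s, best st i = Some s & (index s (val (L i)) <= index t (val (L i)))%N.
Proof. by move=> tL nt; exact: ohead_filter_index. Qed.

Lemma best_prefers st i t : prefers (val (L i)) (best st i) t -> (i, t) \in st.2.
Proof.
move=> /andP[tL pt]; apply/negPn/negP => nt.
have [s es st'] := best_le tL nt.
by move: pt; rewrite es ltnNge st'.
Qed.

Lemma best_mono (st st' : da_state I S) i s : st.2 \subset st'.2 ->
  best st i = Some s -> (i, s) \notin st'.2 -> best st' i = Some s.
Proof.
move=> sub es ns; have [sL _] := bestP es.
have [t et ts] := best_le sL ns; have [tL nt] := bestP et.
have nt' : (i, t) \notin st.2 by apply: contra nt; exact: (subsetP sub).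
have [s' es' st1] := best_le tL nt'; move: es'; rewrite es => -[?]; subst s'.
have eq_ind : index s (val (L i)) = index t (val (L i)).
  by apply/eqP; rewrite eqn_leq st1 ts.
by rewrite et -(nth_index s sL) eq_ind (nth_index s tL).
Qed.

(** [inv_rej] is [stable_unblocked] with rejections in place of preferences and tentative seats in
    place of final ones; at the end [best_prefers] turns preferences into rejections. *)
Record da_inv (st : da_state I S) : Prop := DaInv {
  inv_held : forall i s, st.1 i = Some s -> best st i = Some s;
  inv_rej : forall i t, (i, t) \in st.2 ->
    (C t <= #|[set j | (st.1 j == Some t) && outranks tb p t j i]|)%N
}.

Lemma da_target_best st i : da_inv st -> da_target L st i = best st i.
Proof.
move=> [held _]; rewrite /da_target; case E: (st.1 i) => [s|//].
by rewrite (held _ _ E).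
Qed.

Lemma da_inv_round st : da_inv st -> da_inv (round st).
Proof.
move=> inv; split => [i s|i t].
  rewrite /= ffunE; case E: (da_target L st i) => [s'|//].
  case: ifP => // k [?]; subst s'.
  have eb : best st i = Some s by rewrite -da_target_best.
  apply: (best_mono _ eb); first exact: subsetUl.
  by rewrite in_setU in_set /= k andbF orbF; case: (bestP eb).
move=> rej.
(* It suffices to count the students standing at [t], since [card_top_outranking] passes the bound
   on to those kept. For an old rejection, the holders stand at [t] again; a new one means falling
   outside the top [C t]. *)
have : (C t <= #|[set j in [set j | da_target L st j == Some t]
                      | outranks tb p t j i]|)%N.
  move: rej; rewrite in_setU => /orP[/(inv_rej inv) Ct|].
    apply: (leq_trans Ct); apply/subset_leq_card/subsetP => j.
    rewrite !inE => /andP[/eqP E ->]; rewrite andbT.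
    by rewrite /da_target E.
  rewrite in_set /= => /andP[tgt]; rewrite in_set negb_and in_set tgt /=.
  by rewrite -leqNgt.
move=> /card_top_outranking Ct; apply: (leq_trans Ct).
apply/subset_leq_card/subsetP => j; rewrite !inE => /andP[k ->]; rewrite andbT.
rewrite ffunE; case/andP: (k) => /eqP-> _.
by rewrite /da_kept !inE k eqxx.
Qed.

Lemma da_inv_iter n : da_inv (iter n round (da_start I S)).
Proof.
elim: n => [|n]; last by rewrite iterS; exact: da_inv_round.
by split=> [i s|i t]; rewrite ?ffunE ?inE.
Qed.

(** Had [i] a school left but no seat, one more round would either seat her or reject her; a fixed
    point allows neither. *)
Lemma da_final_best i : (da_final tb C p L).1 i = best (da_final tb C p L) i.
Proof.
have inv : da_inv (da_final tb C p L) := da_inv_iter _.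
have st := da_final_stable tb C p L; set F := da_final _ _ _ _ in inv st *.
case E: (F.1 i) => [s|]; first by rewrite (inv_held inv E).
case B: (best F i) => [s|//].
have [_ /negP[]] := bestP B.
have T := da_target_best i inv; rewrite B in T.
rewrite -st in_setU in_set /= T eqxx /= orbC.
case K: (i \in da_kept tb C p L F s) => //.
by move: E; rewrite -{1}st /= ffunE T K.
Qed.

Lemma da_stable : stable L (DA R tb I S C p L).
Proof.
split=> [i s|s|i t]; rewrite ?/assign /=.
- by rewrite da_final_best => /bestP[].
- exact: da_feasible.
- rewrite da_final_best => /best_prefers.
  exact: (inv_rej (da_inv_iter _)).
Qed.

(** Induction on rounds. If [s] now rejects [i], [C s] students outranking [i] stand at [s], and
    [mu], which seats [i] there, must leave out one of them, [j]. No school has yet rejected a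
    student it gets in [mu], so [j] prefers [s] to her match and blocks [mu]. *)
Lemma da_rejects_no_stable_pair mu n i s : stable L mu ->
  mu i = Some s -> (i, s) \notin (iter n round (da_start I S)).2.
Proof.
move=> [mu_listed mu_feas mu_stab]; elim: n i s => [|n IHn] i s mui.
  by rewrite inE.
have inv := da_inv_iter n; rewrite iterS; set st := iter n _ _ in IHn inv *.
rewrite in_setU negb_or IHn //= in_set /=; apply/negP => /andP[tgt].
rewrite in_set negb_and in_set tgt /= -leqNgt.
set Y := [set j in _ | _] => CY.
have /subsetPn[j] : ~~ (Y \subset [set j | mu j == Some s] :\ i).
  apply/negP => /subset_leq_card /(leq_trans CY).
  have := mu_feas s; rewrite (cardsD1 i) in_set mui eqxx.
  by move=> /leq_trans h /h; rewrite ltnn.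
rewrite in_setD1 !in_set => /andP[/eqP tj ji].
have nij : j != i by apply/eqP => e; rewrite e outranks_irr in ji.
rewrite nij /= => muj; rewrite da_target_best // in tj.
have [sLj _] := bestP tj.
have /mu_stab Cs : prefers (val (L j)) (mu j) s.
  rewrite /prefers sLj /=; case E: (mu j) => [t|//].
  have [s' + st'] := best_le (mu_listed _ _ E) (IHn _ _ E).
  rewrite tj => -[?]; subst s'; rewrite ltn_neqAle st' andbT.
  apply: contra muj => /eqP eq_ind.
  rewrite E -(nth_index s sLj) eq_ind nth_index //; exact: mu_listed E.
(* The [C s] students outranking [j] that [mu] seats at [s] all differ from [i]: one seat too
   many. *)
have := mu_feas s; rewrite (cardsD1 i) in_set mui eqxx leqNgt => /negP[].
rewrite add1n ltnS; apply: (leq_trans Cs); apply/subset_leq_card/subsetP => k.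
rewrite !inE => /andP[-> kj]; rewrite andbT.
by apply: contraTneq kj => ->; apply/negP => /(outranks_trans ji); rewrite outranks_irr.
Qed.

Lemma da_optimal mu i t : stable L mu -> mu i = Some t ->
  exists2 s, DA R tb I S C p L i = Some s
    & (index s (val (L i)) <= index t (val (L i)))%N.
Proof.
move=> stab mui; rewrite /assign /= da_final_best.
apply: best_le; first exact: stable_listed mui.
exact: (da_rejects_no_stable_pair _ stab mui).
Qed.

Lemma card_matched (mu : I -> option S) :
  #|[set i | mu i]| = (\sum_s #|[set i | mu i == Some s]|)%N.
Proof.
rewrite -sum1_card (eq_bigr (fun i => \sum_(s | mu i == Some s) 1)%N).
  rewrite (exchange_big_dep xpredT) //=; apply: eq_bigr => s _.
  rewrite -sum1_card; apply: eq_bigl => i; rewrite !inE.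
  by case: eqP => [->|]; rewrite ?andbT ?andbF.
move=> i; rewrite inE; case: (mu i) => // s _.
by rewrite (big_pred1 s) // => t /=; rewrite eq_sym.
Qed.

(** By [da_optimal] one inclusion holds, so comparing cardinals school by school is enough. A school
    full under [mu] cannot hold more; at a school with a free seat, any student added by deferred
    acceptance would block [mu]. *)
Lemma stable_matched_da mu : stable L mu ->
  [set i | mu i] = [set i | DA R tb I S C p L i].
Proof.
move=> stab; apply/eqP; rewrite eqEcard; apply/andP; split.
  apply/subsetP => i; rewrite !inE; case E: (mu i) => [t|//] _.
  by have [s ->] := da_optimal stab E.
rewrite !card_matched; apply: leq_sum => s _.
case: (ltnP #|[set i | mu i == Some s]| (C s)) => [ltC|]; last first.
  by apply: leq_trans; exact: stable_feasible da_stable s.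
apply/subset_leq_card/subsetP => i; rewrite !inE => /eqP dai.
apply/negPn/negP => mui.
have sL : s \in val (L i) := stable_listed da_stable dai.
have /(stable_unblocked stab) : prefers (val (L i)) (mu i) s.
  rewrite /prefers sL; case E: (mu i) => [t|//] /=.
  have [s' + st] := da_optimal stab E; rewrite dai => -[?]; subst s'.
  rewrite ltn_neqAle st andbT; apply: contra mui => /eqP eq_ind.
  by rewrite E -(nth_index s sL) eq_ind nth_index //; exact: stable_listed E.
rewrite leqNgt => /negP[]; apply: leq_ltn_trans ltC.
by apply/subset_leq_card/subsetP => j; rewrite !inE => /andP[].
Qed.

Lemma stable_unmatched mu nu i : stable L mu -> stable L nu ->
  mu i = None -> nu i = None.
Proof.
move=> /stable_matched_da mu_da /stable_matched_da nu_da mui.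
have /setP/(_ i) := etrans mu_da (esym nu_da).
by rewrite !in_set mui; case: (nu i).
Qed.

End Run.

(** * Strategy-proofness of deferred acceptance *)

Lemma stable_change_list L L' mu i : (forall j, j != i -> L' j = L j) ->
  stable L mu ->
  (forall s, mu i = Some s -> s \in val (L' i)) ->
  (forall t, prefers (val (L' i)) (mu i) t -> prefers (val (L i)) (mu i) t) ->
  stable L' mu.
Proof.
move=> eqL [listed feas unbl] listed' pref'; split=> // [j s|j t].
  by case: (eqVneq j i) => [->|/eqL->]; [exact: listed'|exact: listed].
by case: (eqVneq j i) => [->/pref'/unbl|/eqL->/unbl].
Qed.

Definition match_value (u : S -> R) (o : option S) : R :=
  if o is Some s then u s else 0.

Lemma da_truthful_optimal (u : S -> R) L L' i :
  (forall j, j != i -> L' j = L j) ->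
  sorted (fun s t => u t < u s) (val (L i)) ->
  (forall s, 0 < u s -> s \in val (L i)) ->
  (forall s, s \in val (L i) -> 0 <= u s) ->
  match_value u (DA R tb I S C p L' i) <= match_value u (DA R tb I S C p L i).
Proof.
move=> eqL srt pos nneg; set x := match_value u (DA R tb I S C p L i).
have x_ge0 : 0 <= x.
  rewrite /x; case E: (DA R tb I S C p L i) => [s|//].
  exact/nneg/(stable_listed (da_stable L) E).
case E: (DA R tb I S C p L' i) => [s|//] /=; rewrite leNgt; apply/negP => xs.
have trans_u : transitive (fun s t => u t < u s).
  by move=> a b c ab ca; exact: lt_trans ab.
have sL : s \in val (L i) by apply: pos; exact: le_lt_trans xs.
(* [T] truncates the truthful list strictly above the value [x]; it still contains [s]. *)
have uniqT : uniq [seq t <- val (L i) | x < u t].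
  by apply: filter_uniq; exact: valP.
pose T : rol S := exist (fun l => is_true (uniq l)) _ uniqT.
pose s1 : rol S := exist _ [:: s] isT.
pose LT := @dfwith I (fun=> rol S) L i T.
pose Ls := @dfwith I (fun=> rol S) L i s1.
have LTi : LT i = T by exact: dfwith_in.
have Lsi : Ls i = s1 by exact: dfwith_in.
have LTj j : j != i -> LT j = L j by move=> ji; rewrite /LT dfwith_out // eq_sym.
have Lsj j : j != i -> Ls j = L j by move=> ji; rewrite /Ls dfwith_out // eq_sym.
have sT : s \in val T by rewrite mem_filter xs.
(* With a match [t] under [T], the matching would be stable for [L] too, as [T] is an initial
   segment of the sorted list; by [da_optimal], [x] would be at least [u t], but [T] only has
   schools above [x]. *)
have DAT : DA R tb I S C p LT i = None.
  case D: (DA R tb I S C p LT i) => [t|//].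
  have := stable_listed (da_stable LT) D; rewrite LTi mem_filter => /andP[xt tL].
  have stab : stable L (DA R tb I S C p LT).
    apply: (@stable_change_list LT _ _ i).
    - by move=> j ji; rewrite LTj.
    - exact: da_stable.
    - by move=> t'; rewrite D => -[<-].
    - move=> t'; rewrite D LTi => /andP[t'L t't].
      have ut : u t < u t' := sorted_ltn_index trans_u srt _ _ t'L tL t't.
      rewrite /prefers mem_filter (lt_trans xt ut) t'L /= ltnNge leq_eqVlt negb_or.
      have t'T : t' \in val T by rewrite mem_filter (lt_trans xt ut).
      have tT : t \in val T by rewrite mem_filter xt.
      apply/andP; split.
        apply/eqP => e; move: ut; rewrite -(nth_index s tT) e nth_index //.
        by rewrite ltxx.
      apply/negP => /(sorted_ltn_index trans_u (sorted_filter trans_u _ srt) _ _ tT t'T).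
      by rewrite ltNge (ltW ut).
  have [t' D' t't] := da_optimal stab D.
  have t'L := stable_listed (da_stable L) D'.
  move: xt; rewrite /x D' /= ltNge => /negP[].
  move: t't; rewrite leq_eqVlt => /predU1P[e|lt].
    by rewrite -(nth_index s t'L) e nth_index.
  exact/ltW/(sorted_ltn_index trans_u srt _ _ t'L tL lt).
have stab' : stable Ls (DA R tb I S C p L').
  apply: (@stable_change_list L' _ _ i).
  - by move=> j ji; rewrite Lsj // eqL.
  - exact: da_stable.
  - by move=> t; rewrite E Lsi => -[<-]; rewrite mem_head.
  - by move=> t; rewrite E Lsi /prefers /= eqxx ltn0 andbF.
have stabT : stable Ls (DA R tb I S C p LT).
  apply: (@stable_change_list LT _ _ i).
  - by move=> j ji; rewrite Lsj // LTj.
  - exact: da_stable.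
  - by move=> t; rewrite DAT.
  - move=> t; rewrite DAT Lsi LTi /prefers !andbT.
    by rewrite mem_seq1 => /eqP->.
by have := stable_unmatched stabT stab' DAT; rewrite E.
Qed.

(** Otherwise stability would fill the seats of [s], of which there is at least one, with students
    outranking [i]. *)
Lemma da_top_first_choice L i s : (0 < C s)%N -> onth (val (L i)) 0 = Some s ->
  (forall j, ~~ outranks tb p s j i) -> DA R tb I S C p L i = Some s.
Proof.
move=> Cs Li top_i; apply/eqP/negPn/negP => /eqP dai.
case EL: (val (L i)) Li => [//|x r] [?]; subst x.
have /(stable_unblocked (da_stable L)) :
    prefers (val (L i)) (DA R tb I S C p L i) s.
  rewrite /prefers EL mem_head /= eqxx; case E: (DA R tb I S C p L i) => [t|//].
  by case: eqP => // e; rewrite E e in dai.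
move=> /(leq_trans Cs) /card_gt0P[j].
by rewrite in_set (negbTE (top_i j)) andbF.
Qed.

(** Admissions are final, so only rivals ranking [s] first compete with [i], and a seat obtained in
    round 0 is never lost. *)
Lemma ia_first_choice L i s : (0 < C s)%N -> onth (val (L i)) 0 = Some s ->
  (forall j, onth (val (L j)) 0 = Some s -> ~~ outranks tb p s j i) ->
  IA R tb I S C p L i = Some s.
Proof.
move=> Cs Li top_i; rewrite /assign /= /ia_final.
have -> : iota 0 #|S| = 0 :: iota 1 #|S|.-1.
  by rewrite -[#|S| in LHS]prednK //; apply/card_gt0P; exists s.
rewrite /=; set mu0 := ia_round _ _ _ _ _ _.
have : mu0 i = Some s.
  rewrite /mu0 ffunE ffunE Li in_set.
  rewrite [X in (_ < _ - X)%N](_ : _ = 0%N); last first.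
    by apply: eq_card0 => j; rewrite !inE ffunE.
  rewrite [X in (X < _)%N](_ : _ = 0%N); last first.
    apply: eq_card0 => j; rewrite !inE ffunE eqxx /=.
    by case: eqP => //= /top_i/negbTE.
  by rewrite subn0 Cs in_set ffunE Li !eqxx.
elim: (iota _ _) mu0 => //= k r IHr mu mui; apply: IHr.
by rewrite ffunE mui.
Qed.

End Stability.

Lemma da_strategy_proof (R : realType) (tb : tie_breaking) :
  strategy_proof (DA R tb).
Proof.
move=> E sigma i a L [srt pos nneg] L'.
(* Priorities depend on actions alone, which both profiles share. *)
have eqp : (fun j s => realized_prio s (play sigma (a, L') j).1) =
    (fun j s => realized_prio s (play sigma (a, L) j).1).
  apply/funext => j; apply/funext => s; congr realized_prio; rewrite /play.
  by case: (eqVneq i j) => [<-|ij]; rewrite ?dfwith_in ?dfwith_out.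
rewrite /utility /outcome eqp /play !dfwith_in lerD2r.
apply: da_truthful_optimal; rewrite ?dfwith_in // => j ji.
by rewrite !dfwith_out // eq_sym.
Qed.

Lemma assign_capacity_gt0 (R : realType) (phi : mechanism R) (I S : finType)
    (C : S -> nat) (p : I -> S -> R) (L : I -> rol S) i s :
  phi I S C p L i = Some s -> (0 < C s)%N.
Proof.
move=> e; apply: leq_trans (assign_feasible phi C p L s).
by apply/card_gt0P; exists i; rewrite inE e.
Qed.

Lemma assign_capacity1_inj (R : realType) (phi : mechanism R) (I S : finType)
    (C : S -> nat) (p : I -> S -> R) (L : I -> rol S) i j s :
  C s = 1%N -> phi I S C p L i = Some s -> phi I S C p L j = Some s -> i = j.
Proof.
move=> Cs ei ej; have := assign_feasible phi C p L s; rewrite Cs.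
by move=> /card_le1_eqP; apply; rewrite inE ?ei ?ej.
Qed.

(** * A contest of two students for one seat *)

Section Counterexample.
Variables (R : realType) (tb : tie_breaking).

Fact one_itv : 0 <= (1 : R) <= 1. Proof. by rewrite ler01 lexx. Qed.

Fact half_gt0 : 0 < 2^-1 :> R. Proof. by rewrite invr_gt0. Qed.

(** The seatless school [false] is worth more, which makes [false_then_true] truthful; the contested
    seat is worth 1, above the deception cost 1/2. *)
Definition contest_value (_ s : bool) : R := if s then 1 else 2.

Fact contest_value_inj i : injective (contest_value i).
Proof. by case=> -[] //= /eqP; rewrite /contest_value => /eqP ?; exfalso; lra. Qed.

Definition contest_prio (i _ a : bool) : R :=
  if i then (if a then 1 else 0) else 2^-1.

Fact contest_prio_itv (i s a : bool) : 0 <= contest_prio i s a <= 1.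
Proof. by rewrite /contest_prio; case: i; case: a; lra. Qed.

(* School [false] has no seats and school [true] has one.  Student [true] can
   raise her priority from 0 to 1; student [false] always has priority 1/2. *)
Definition contest : economy R :=
  @Economy R bool bool nat_of_bool 1 one_itv 2^-1 half_gt0 (fun=> bool)
    (fun=> false) (fun=> ex_intro (fun a => is_true (a != false)) true isT)
    contest_value contest_value_inj
    (fun _ _ => 1) (fun _ _ => one_itv) contest_prio contest_prio_itv.

Definition only_true : rol bool := exist _ [:: true] isT.
Definition false_then_true : rol bool := exist _ [:: false; true] isT.

Definition contest_profile : profile contest := fun i => (false, only_true).

Definition contest_play (a : bool) (L : rol bool) : profile contest :=
  play contest_profile (i := (true : student contest)) (a, L).

Lemma contest_utility phi a L :
  utility phi (contest_play a L) true =
  match_value (contest_value true) (outcome phi (contest_play a L) true)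
  - (if a then 2^-1 else 0).
Proof. by rewrite /utility /contest_play /play dfwith_in; case: a. Qed.

Lemma contest_listE a L i :
  (contest_play a L i).2 = if i then L else only_true.
Proof. by rewrite /contest_play /play; case: i; rewrite ?dfwith_in ?dfwith_out. Qed.

Lemma contest_prioE a L i s :
  realized_prio s (contest_play a L i).1 = contest_prio i s a.
Proof.
rewrite /realized_prio /= subrr mul0r addr0 mul1r.
by rewrite /contest_play /play; case: i; rewrite ?dfwith_in ?dfwith_out.
Qed.

Lemma contest_loser phi a L :
  outcome phi (contest_play a L) false = Some true ->
  outcome phi (contest_play a L) true = None.
Proof.
move=> Of; case Ot: (outcome phi (contest_play a L) true) => [[]|//].
  have seat : capacity (true : school contest) = 1%N by [].
  by have := assign_capacity1_inj seat Of Ot.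
by have := assign_capacity_gt0 Ot.
Qed.

(** The hypothesis is a property shared by [DA] and [IA]. Honesty gives student [true] utility 0
    whatever her list; deceiving and listing only [true] gives 1 - 1/2. *)
Lemma contest_not_deception_proof (phi : mechanism R) :
  (forall (I S : finType) (C : S -> nat) (p : I -> S -> R) (L : I -> rol S) i s,
    (0 < C s)%N -> onth (val (L i)) 0 = Some s ->
    (forall j, ~~ outranks tb p s j i) -> phi I S C p L i = Some s) ->
  ~ deception_proof phi.
Proof.
move=> top_first /(_ contest contest_profile true)[L /(_ (true, only_true))].
rewrite -[X in utility _ X _ <= _]/(contest_play true only_true).
rewrite -[X in _ <= utility _ X _]/(contest_play false L) !contest_utility.
(* Priority 1/2 against 0 gives the seat to student [false] for every list [L]. *)
rewrite (@contest_loser phi false L); last first.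
  apply: top_first => //; first by rewrite contest_listE.
  by case; rewrite ?outranks_irr ?lt_not_outranks // !contest_prioE /contest_prio; lra.
have -> : outcome phi (contest_play true only_true) true = Some true.
  apply: top_first => //; first by rewrite contest_listE.
  by case; rewrite ?outranks_irr ?lt_not_outranks // !contest_prioE /contest_prio; lra.
by rewrite /=; lra.
Qed.

Lemma contest_ia_not_strategy_proof : ~ strategy_proof (IA R tb).
Proof.
move=> /(_ contest contest_profile true true false_then_true).
have truth : @truthful R contest true false_then_true.
  split=> [|[]|s] //=; first by rewrite /contest_value; lra.
  by move=> _; case: s; rewrite /contest_value; lra.
move=> /(_ truth only_true).
rewrite -[X in utility _ X _ <= _]/(contest_play true only_true).
rewrite -[X in _ <= utility _ X _]/(contest_play true false_then_true).
(* Student [true] has the higher priority but applies elsewhere in round 0, so her rival takes the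
   seat: utility -1/2, against 1/2 with [only_true]. *)
rewrite !contest_utility (@contest_loser _ true false_then_true); last first.
  apply: ia_first_choice => //; first by rewrite contest_listE.
  by case; rewrite contest_listE //= outranks_irr.
have -> : outcome (IA R tb) (contest_play true only_true) true = Some true.
  apply: ia_first_choice => //; first by rewrite contest_listE.
  by case=> _; rewrite ?outranks_irr ?lt_not_outranks // !contest_prioE /contest_prio; lra.
by rewrite /=; lra.
Qed.

End Counterexample.

Theorem proposition1 (R : realType) (tb : tie_breaking) :
  [/\ strategy_proof (DA R tb),
      ~ strategy_proof (IA R tb),
      ~ deception_proof (DA R tb)
    & ~ deception_proof (IA R tb)].
Proof.
split; first exact: da_strategy_proof.
- exact: contest_ia_not_strategy_proof.
- apply: (@contest_not_deception_proof _ tb) => *; exact: da_top_first_choice.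
- apply: (@contest_not_deception_proof _ tb) => I S C p L i s Cs Li top_i.
  by apply: ia_first_choice => // j _.
Qed.
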